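(* Assume $\{P_\theta:\theta\in\Theta\subset\mathbb R\}$ admits a real-valued statistic $T(X)$ whose density $p_\theta(t)$ has monotone likelihood ratio in $t$. Suppose that for each $\alpha\in(0,1)$ and each $\theta_0\in\Theta$ there exists a strictly unbiased UMP unbiased level-$\alpha$ test of $H(\theta_0):\theta=\theta_0$ whose acceptance region is of the form $$\mathcal A_{\theta_0,\alpha}=\{t:\ a_\alpha(\theta_0)\le t\le b_\alpha(\theta_0)\},$$ with $a_\alpha(\cdot)$ and $b_\alpha(\cdot)$ strictly increasing, so that the inverted confidence set $$C_\alpha^\star(X)=\{\theta\in\Theta:\ T(X)\in\mathcal A_{\theta,\alpha}\}=\big[b_\alpha^{-1}\{T(X)\},\ a_\alpha^{-1}\{T(X)\}\big]$$ is a most accurate unbiased $(1-\alpha)$ confidence interval for $\theta$. Assume moreover that $\{C_\alpha^\star(X):\alpha\in(0,1)\}$ can be chosen nested in $\alpha$ and that $E_\theta|C_\alpha^\star(X)|<\infty$ for all $\theta,\alpha$. Define the induced possibility contour by stacking, $$\pi_X^\star(\vartheta)=\sup\{\alpha\in[0,1]:\ \vartheta\in C_\alpha^\star(X)\},\qquad\vartheta\in\Theta,$$ and let $\Pi_X^\star$ be the corresponding possibility measure. Then $\Pi_X^\star$ is valid and possibilistically unbiased. Furthermore, for the concentration penalty $\Gamma_x(\vartheta)=|A_{\pi_x(\vartheta)}(x)|$ (integrated expected length), the procedure $\Pi^\star=\{\Pi_X^\star\}$ minimizes Choquet risk pointwise in $\theta$ over the class of valid, possibilistically unbiased procedures whose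 $\alpha$-cuts are unbiased $(1-\alpha)$ confidence intervals with finite expected length. That is, $\Pi^\star$ is concentration-optimal among unbiased valid contours.
   Context: A data-dependent possibility procedure is a family $\Pi=\{\Pi_x\}$ of possibility measures $\Pi_x(B)=\sup_{\vartheta\in B}\pi_x(\vartheta)$ with contours $\pi_x:\Theta\to[0,1]$ and $\alpha$-cuts $A_\alpha(x)=\{\vartheta:\pi_x(\vartheta)\ge\alpha\}$. It is valid if $P_\theta\{\pi_X(\theta)<\alpha\}\le\alpha$ for all $\theta\in\Theta,\alpha\in[0,1]$. It is possibilistically unbiased if $P_\theta\{\pi_X(\theta)\le\alpha\}\le P_\vartheta\{\pi_X(\theta)\le\alpha\}$ for all $\theta,\vartheta\in\Theta$, $\alpha\in[0,1]$. $|A|$ denotes Lebesgue measure (length). For a penalty $\Gamma_x$ the Choquet loss is $L(\theta,\Pi_x)=\int_0^1\sup_{\vartheta\in A_\alpha(x)}\Gamma_x(\vartheta)\,d\alpha$ and the Choquet risk is $R(\theta,\Pi)=E_\theta\{L(\theta,\Pi_X)\}$; the concentration penalty $\Gamma_x(\vartheta)=|A_{\pi_x(\vartheta)}(x)|$ is formed from each procedure's own contour and cuts. Classical terms: a level-$\alpha$ test of $\theta=\theta_0$ is unbiased if its power is at least $\alpha$ at every $\theta\neq\theta_0$, strictly unbiased if its power exceeds $\alpha$ there, and UMP unbiased if it is uniformly most powerful among unbiased level-$\alpha$ tests. A $(1-\alpha)$ confidence set $C$ (i.e. $P_\theta\{\theta\in C(X)\}\ge1-\alpha$ for all $\theta$)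 is unbiased if $P_\theta\{\theta\in C(X)\}\ge P_\vartheta\{\theta\in C(X)\}$ for all $\theta,\vartheta$; it is most accurate unbiased if it minimizes the false-coverage probabilities $P_\vartheta\{\theta\in C(X)\}$, for all $\theta\ne\vartheta$, among unbiased $(1-\alpha)$ confidence sets. Nested in $\alpha$ means $C^\star_{\alpha_2}\subseteq C^\star_{\alpha_1}$ for $\alpha_1<\alpha_2$. *)

(* Defs.v *)
From HB Require Import structures.
From mathcomp Require Import all_boot all_order all_algebra.
From mathcomp Require Import all_classical all_reals all_analysis.

Set Implicit Arguments.
Unset Strict Implicit.
Unset Printing Implicit Defensive.
Import Order.TTheory GRing.Theory Num.Theory.
Import numFieldNormedType.Exports.

Local Open Scope classical_set_scope.
Local Open Scope ring_scope.

(* A statistical model is a family [P : R -> probability X R] of which only the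
   members [P theta] with [Theta theta] matter. *)

Section densities.
Context {d : measure_display} {X : measurableType d} {R : realType}.
Implicit Types (Theta : set R) (P : R -> probability X R).

(* The dominating measure [mu] is arbitrary sigma-finite; Lebesgue measure is
   the case of densities on the line. *)
Definition has_density Theta P (T : {mfun X >-> R})
    (mu : {sigma_finite_measure set R -> \bar R}) (p : R -> R -> R) : Prop :=
  forall theta, Theta theta ->
    [/\ measurable_fun [set: R] (p theta),
        forall t, 0 <= p theta t &
        forall B : set R, measurable B ->
          distribution (P theta) T B = (\int[mu]_(t in B) (p theta t)%:E)%E].

(* p_theta2 / p_theta1, with c / 0 = +oo for c > 0; it is used only where the
   two densities do not both vanish. *)
Definition likelihood_ratio (p : R -> R -> R) (theta1 theta2 t : R) : \bar R :=
  if p theta1 t == 0 then +oo%E else (p theta2 t / p theta1 t)%:E.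

Definition monotone_likelihood_ratio Theta (p : R -> R -> R) : Prop :=
  forall theta1 theta2, Theta theta1 -> Theta theta2 -> theta1 < theta2 ->
  forall t1 t2, t1 < t2 ->
    (p theta1 t1 != 0) || (p theta2 t1 != 0) ->
    (p theta1 t2 != 0) || (p theta2 t2 != 0) ->
    (likelihood_ratio p theta1 theta2 t1
       <= likelihood_ratio p theta1 theta2 t2)%E.

End densities.

Section tests.
Context {d : measure_display} {X : measurableType d} {R : realType}.
Variables (Theta : set R) (P : R -> probability X R).
Implicit Types (alpha theta : R) (phi : X -> R).

(* Tests are critical functions: [phi x] is the probability of rejecting when
   [x] is observed, so randomized tests are included. *)
Definition is_test phi : Prop :=
  measurable_fun [set: X] phi /\ forall x, 0 <= phi x <= 1.

Definition power phi (theta : R) : \bar R := (\int[P theta]_x (phi x)%:E)%E.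

Definition level_test alpha theta0 phi : Prop :=
  is_test phi /\ (power phi theta0 <= alpha%:E)%E.

Definition unbiased_test alpha theta0 phi : Prop :=
  level_test alpha theta0 phi /\
  forall theta, Theta theta -> theta != theta0 ->
    (alpha%:E <= power phi theta)%E.

Definition strictly_unbiased_test alpha theta0 phi : Prop :=
  level_test alpha theta0 phi /\
  forall theta, Theta theta -> theta != theta0 ->
    (alpha%:E < power phi theta)%E.

Definition UMP_unbiased_test alpha theta0 phi : Prop :=
  unbiased_test alpha theta0 phi /\
  forall psi, unbiased_test alpha theta0 psi ->
  forall theta, Theta theta -> theta != theta0 ->
    (power psi theta <= power phi theta)%E.

Definition test_of_acceptance (T : X -> R) (A : set R) : X -> R :=
  fun x => \1_(~` A) (T x).

End tests.

Section confidence_sets.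
Context {d : measure_display} {X : measurableType d} {R : realType}.
Variables (Theta : set R) (P : R -> probability X R).
Implicit Types (C : X -> set R) (alpha : R).

Definition confidence_set alpha C : Prop :=
  [/\ forall x, C x `<=` Theta,
      forall theta, Theta theta -> measurable [set x | C x theta] &
      forall theta, Theta theta ->
        ((1 - alpha)%:E <= P theta [set x | C x theta])%E].

Definition unbiased_confidence_set alpha C : Prop :=
  confidence_set alpha C /\
  forall theta vartheta, Theta theta -> Theta vartheta ->
    (P vartheta [set x | C x theta] <= P theta [set x | C x theta])%E.

Definition most_accurate_unbiased alpha C : Prop :=
  unbiased_confidence_set alpha C /\
  forall C', unbiased_confidence_set alpha C' ->
  forall theta vartheta, Theta theta -> Theta vartheta -> theta != vartheta ->
    (P vartheta [set x | C x theta] <= P vartheta [set x | C' x theta])%E.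

(* Interval of the parameter space: the trace on [Theta] of a real interval. *)
Definition interval_valued C : Prop :=
  forall x, exists2 J : set R, is_interval J & C x = Theta `&` J.

Definition expected_length C (theta : R) : \bar R :=
  (\int[P theta]_x lebesgue_measure (C x))%E.

End confidence_sets.

Section possibility.
Context {d : measure_display} {X : measurableType d} {R : realType}.
Variables (Theta : set R) (P : R -> probability X R).
Implicit Types (pi : X -> R -> R) (Pi : X -> set R -> R).

(* [sup set0 = 0], the value of a possibility measure at the empty set. *)
Definition possibility_of pi : X -> set R -> R :=
  fun x B => sup (pi x @` B).

Definition contour Pi : X -> R -> R := fun x t => Pi x [set t].

(* Joint measurability of the contour makes the probabilities, lengths and
   expectations below meaningful. *)
Definition possibility_procedure Pi : Prop :=
  [/\ forall x (B : set R), B `<=` Theta ->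
        Pi x B = possibility_of (contour Pi) x B,
      forall x t, Theta t -> 0 <= contour Pi x t <= 1 &
      measurable_fun ([set: X] `*` Theta)
        (fun z : X * R => contour Pi z.1 z.2)].

Definition cut Pi (alpha : R) : X -> set R :=
  fun x => [set t | Theta t /\ alpha <= contour Pi x t].

Definition valid Pi : Prop :=
  forall theta alpha, Theta theta -> 0 <= alpha <= 1 ->
    (P theta [set x | (contour Pi x theta < alpha)%R] <= alpha%:E)%E.

Definition possibilistically_unbiased Pi : Prop :=
  forall theta vartheta alpha, Theta theta -> Theta vartheta ->
    0 <= alpha <= 1 ->
    (P theta [set x | (contour Pi x theta <= alpha)%R]
       <= P vartheta [set x | (contour Pi x theta <= alpha)%R])%E.

(* Penalties are nonnegative, so the supremum over an empty cut is 0 (whereas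
   [ereal_sup set0 = -oo]). *)
Definition choquet_loss (Gamma : X -> R -> \bar R) Pi (x : X) : \bar R :=
  (\int[lebesgue_measure]_(alpha in `[0%R, 1%R])
     ereal_sup (0 |` (Gamma x @` cut Pi alpha x)))%E.

Definition choquet_risk (Gamma : X -> R -> \bar R) Pi (theta : R) : \bar R :=
  (\int[P theta]_x choquet_loss Gamma Pi x)%E.

Definition concentration_penalty Pi : X -> R -> \bar R :=
  fun x t => lebesgue_measure (cut Pi (contour Pi x t) x).

(* The cut at level 0 is all of [Theta], possibly of infinite length: as for the
   stacked confidence sets, the levels range over the open unit interval. *)
Definition unbiased_interval_cuts Pi : Prop :=
  forall alpha, 0 < alpha < 1 ->
    [/\ unbiased_confidence_set Theta P alpha (cut Pi alpha),
        interval_valued Theta (cut Pi alpha) &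
        forall theta, Theta theta ->
          (expected_length P (cut Pi alpha) theta < +oo)%E].

Definition competitor Pi : Prop :=
  [/\ possibility_procedure Pi, valid Pi, possibilistically_unbiased Pi &
      unbiased_interval_cuts Pi].

Definition concentration_optimal Pi : Prop :=
  competitor Pi /\
  forall Pi', competitor Pi' -> forall theta, Theta theta ->
    (choquet_risk (concentration_penalty Pi) Pi theta
       <= choquet_risk (concentration_penalty Pi') Pi' theta)%E.

(* [sup set0 = 0]: the contour vanishes at points lying in no [C alpha x]. *)
Definition stacked_contour (C : R -> X -> set R) : X -> R -> R :=
  fun x t => sup [set alpha | 0 < alpha < 1 /\ C alpha x t].

End possibility.

Definition acceptance_region {R : realType} (a b : R -> R -> R)
    (theta alpha : R) : set R :=
  [set t | a alpha theta <= t <= b alpha theta].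

Definition inverted_set {X : Type} {R : realType} (Theta : set R) (T : X -> R)
    (a b : R -> R -> R) (alpha : R) : X -> set R :=
  fun x => [set theta | Theta theta /\ acceptance_region a b theta alpha (T x)].

Definition strictly_increasing_on {R : realType} (Theta : set R) (f : R -> R)
  : Prop :=
  forall s t, Theta s -> Theta t -> s < t -> f s < f t.

(* Main.v *)
Require Import Defs.
From HB Require Import structures.
From mathcomp Require Import all_boot all_order all_algebra.
From mathcomp Require Import all_classical all_reals all_analysis.
From mathcomp Require Import measurable_realfun.

Set Implicit Arguments.
Unset Strict Implicit.
Unset Printing Implicit Defensive.
Import Order.TTheory GRing.Theory Num.Theory.
Import numFieldNormedType.Exports.

Local Open Scope classical_set_scope.
Local Open Scope ring_scope.

(** The stacked procedure is optimal because its cuts are, level by level.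

    Write [C alpha] for the inverted sets and [sc] for the contour stacked from
    them.  Inverting the tests gives, for [0 < alpha < 1], coverage at least
    [1 - alpha] and false coverage at most [1 - alpha], and [C alpha] is most
    accurate unbiased ([inverted_set_most_accurate]).  An unbiased confidence
    set of coverage [q > 1 - alpha] at the tested value need not give an
    unbiased test of level [alpha]; the randomized test rejecting with
    probability [1 - (1 - alpha) / q] when the set contains the tested value,
    and always otherwise, is one of size [alpha], and rejects at least as often
    as the set misses that value.

    By nestedness the cut of [sc] at [alpha] is the intersection of the sets
    [C beta] over [0 < beta < alpha].  It may be larger than [C alpha], but the
    events [sc < alpha] and [sc > alpha] are increasing unions of events at
    nearby levels, so continuity of measures transfers to [sc] the bounds that
    hold for the [C beta]: this gives validity, possibilistic unbiasedness, and
    most accuracy of the cuts of [sc] among the cuts of all competitors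
    ([stacked_cut_most_accurate]).

    For the concentration penalty of a procedure, the supremum of the penalty
    over the cut at [alpha] is the length of that cut
    ([ereal_sup_concentration]).  By Tonelli, first in the level and then, as in
    the Ghosh-Pratt identity, in the parameter, the Choquet risk at [theta] is
    the integral over levels [alpha] and parameters [t] of the probability under
    [theta] that the cut at [alpha] covers [t].  The integrand with [t] distinct
    from [theta] is a false-coverage probability, minimized by the cuts of
    [sc], and the single parameter [t = theta] has length zero. *)

(* The unqualified name also denotes the Dedekind cuts of the real line. *)
Local Notation cut := Defs.cut.

(** * Continuity of measures at a level *)

Section continuity_at_levels.
Context {d : measure_display} {X : measurableType d} {R : realType}.
Variables (mu : {measure set X -> \bar R}) (D : set X) (f : X -> R).
Hypotheses (mD : measurable D) (mf : measurable_fun D f).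

Lemma measurable_superlevel r : measurable (D `&` [set x | r < f x]).
Proof.
have -> : [set x | r < f x] = f @^-1` `]r, +oo[.
  by apply/seteqP; split => x /=; rewrite in_itv/= andbT.
exact: mf.
Qed.

(** The superlevel set at [r] is the increasing union of those at [s > r]. *)
Lemma measure_superlevel_le r c :
  (forall s, r < s -> (mu (D `&` [set x | (s < f x)%R]) <= c)%E) ->
  (mu (D `&` [set x | (r < f x)%R]) <= c)%E.
Proof.
move=> Hc; pose F n := D `&` [set x | r + n.+1%:R^-1 < f x].
have FE : D `&` [set x | r < f x] = \bigcup_n F n.
  apply/seteqP; split => [x [Dx /= rf]|x [n _ [Dx /= nf]]].
    by have [k kf] := ltr_add_invr rf; exists k.
  by split => //=; apply: le_lt_trans nf; rewrite lerDl invr_ge0.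
have mF n : measurable (F n) by exact: measurable_superlevel.
have ndF : nondecreasing_seq F.
  move=> m n mn; apply/subsetPset => x [Dx /= mf']; split => //=.
  by apply: le_lt_trans mf'; rewrite lerD2l lef_pV2 ?posrE// ler_nat.
rewrite FE.
have cv : mu \o F @ \oo --> mu (\bigcup_n F n).
  by apply: nondecreasing_cvg_mu => //; exact: bigcup_measurable.
rewrite -(cvg_lim _ cv)//; apply: lime_le.
  by apply/cvg_ex; eexists; exact: cv.
by apply: nearW => n; apply: Hc; rewrite ltrDl invr_gt0.
Qed.

End continuity_at_levels.

Lemma measure_sublevel_le {d : measure_display} {X : measurableType d}
    {R : realType} (mu : {measure set X -> \bar R}) (f : X -> R) (r : R)
    (c : \bar R) : measurable_fun [set: X] f ->
  (forall s, s < r -> (mu [set x | (f x < s)%R] <= c)%E) ->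
  (mu [set x | (f x < r)%R] <= c)%E.
Proof.
move=> mf Hc.
have sub s : [set x | f x < s] = setT `&` [set x | - s < - f x].
  by rewrite setTI; apply/seteqP; split => x /=; rewrite ltrN2.
rewrite sub; apply: measure_superlevel_le => //.
  exact: measurableT_comp.
by move=> s rs; rewrite -[s]opprK -sub; apply: Hc; rewrite ltrNl.
Qed.

(** * Length of cuts and Choquet risk *)

Section cuts.
Context {d : measure_display} {X : measurableType d} {R : realType}.
Variables (Theta : set R) (mTheta : measurable Theta).
Variables (P : R -> probability X R).
Implicit Types Pi : X -> set R -> R.

Lemma measurable_cut_graph Pi : possibility_procedure Theta Pi ->
  measurable [set z : (X * R) * R | cut Theta Pi z.1.2 z.1.1 z.2].
Proof.
move=> [_ _ mpi]; pose D := [set z : (X * R) * R | Theta z.2].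
have mD : measurable D.
  by rewrite -[D]setTI; exact: (@measurable_snd _ _ _ _ measurableT Theta).
have mg : measurable_fun D (fun z : (X * R) * R => contour Pi z.1.1 z.2).
  have -> : (fun z : (X * R) * R => contour Pi z.1.1 z.2) =
     (fun z : X * R => contour Pi z.1 z.2) \o (fun z => (z.1.1, z.2)) by [].
  apply: (@measurable_comp _ _ _ _ _ _ ([set: X] `*` Theta)) => //.
  - exact: measurableX.
  - by move=> _ [z Dz <-].
  - apply: measurable_funTS; apply: measurable_fun_pair => //.
    exact: measurableT_comp.
have mh : measurable_fun D (fun z : (X * R) * R => z.1.2).
  by apply: measurable_funTS; exact: measurableT_comp.
exact: measurable_fun_le mD mh mg.
Qed.

Lemma measurable_cut_section Pi alpha : possibility_procedure Theta Pi ->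
  measurable [set z : X * R | cut Theta Pi alpha z.1 z.2].
Proof.
move=> /measurable_cut_graph mG; rewrite -[X in measurable X]setTI.
have mk : measurable_fun setT (fun z : X * R => ((z.1, alpha), z.2)).
  by apply: measurable_fun_pair => //; exact: measurable_fun_pair.
exact: (mk measurableT _ mG).
Qed.

Lemma measurable_cut Pi alpha x : possibility_procedure Theta Pi ->
  measurable (cut Theta Pi alpha x).
Proof.
move=> /(@measurable_cut_section _ alpha) /(measurable_xsection x).
by rewrite xsectionE.
Qed.

Lemma measurable_coverage Pi alpha t : possibility_procedure Theta Pi ->
  measurable [set x | cut Theta Pi alpha x t].
Proof.
move=> /(@measurable_cut_section _ alpha) /(measurable_ysection t).
by rewrite ysectionE.
Qed.

Lemma measurable_contour Pi t : possibility_procedure Theta Pi -> Theta t ->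
  measurable_fun [set: X] (fun x => contour Pi x t).
Proof.
move=> [_ _ mpi] Tt.
apply: (@measurable_comp _ _ _ _ _ _ ([set: X] `*` Theta)
  (fun z : X * R => contour Pi z.1 z.2) _ (fun x => (x, t))) => //.
- exact: measurableX.
- by move=> _ [x _ <-].
Qed.

(** Let [s] be the infimum of the contour on the cut at [alpha], so that the cut
    at [s] is the same set.  If [s] is attained, the penalty there is the length
    of the cut; otherwise the cut is the increasing union of the cuts at the
    levels of its own points. *)
Lemma ereal_sup_concentration Pi alpha x : possibility_procedure Theta Pi ->
  ereal_sup
    (0%E |` (concentration_penalty Theta Pi x @` cut Theta Pi alpha x)) =
  lebesgue_measure (cut Theta Pi alpha x).
Proof.
move=> HPi; set B := cut Theta Pi alpha x; apply/eqP; rewrite eq_le.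
apply/andP; split.
  apply: ge_ereal_sup => _ [->//|[t [Tt at_] <-]].
  apply: le_measure; [by rewrite inE; exact: measurable_cut..|].
  by move=> u [Tu tu]; split => //; exact: le_trans tu.
have [->|/set0P[t0 Bt0]] := eqVneq B set0.
  by rewrite measure0; apply: ereal_sup_ubound; left.
set S := (X in ereal_sup X).
pose s := inf (contour Pi x @` B).
have hi : has_inf (contour Pi x @` B).
  by split; [exists (contour Pi x t0), t0|exists alpha => _ [t [_ ?] <-]].
have sB t : B t -> s <= contour Pi x t.
  by move=> Bt; apply: ge_inf; [exact: hi.2|exists t].
have Bs : B = cut Theta Pi s x.
  apply/seteqP; split => t; first by move=> Bt; split; [exact: Bt.1|exact: sB].
  move=> [Tt st]; split => //; apply: le_trans st.
  by apply: lb_le_inf => [|_ [u [_ ?] <-]]; first exact: hi.1.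
have [[t Bt ts]|Hs] := pselect (exists2 t, B t & contour Pi x t = s).
  apply: ereal_sup_ubound; right; exists t => //.
  by rewrite /concentration_penalty ts -Bs.
have -> : B = Theta `&` [set t | s < contour Pi x t].
  apply/seteqP; split => t; last by move=> [Tt /= /ltW st]; rewrite Bs.
  move=> Bt; split; first exact: Bt.1.
  by rewrite /= lt_neqAle sB// andbT; apply/eqP => st; apply: Hs; exists t.
have mpi : measurable_fun Theta (contour Pi x).
  have [_ _ mpi] := HPi.
  apply: (@measurable_comp _ _ _ _ _ _ ([set: X] `*` Theta)
    (fun z : X * R => contour Pi z.1 z.2) _ (fun t => (x, t))) => //.
  - exact: measurableX.
  - by move=> _ [t Tt <-].
  - by apply: measurable_funTS; exact: measurable_fun_pair.
apply: measure_superlevel_le => // r sr.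
have rs0 : 0 < r - s by rewrite subr_gt0.
have [_ [t Bt <-] tr] := inf_adherent rs0 hi.
rewrite addrC subrK in tr.
apply: (@le_trans _ _ (concentration_penalty Theta Pi x t)); last first.
  by apply: ereal_sup_ubound; right; exists t.
apply: le_measure.
- by rewrite inE; exact: measurable_superlevel.
- by rewrite inE; exact: measurable_cut.
- by move=> u [Tu /= ru]; split => //; exact/ltW/(lt_trans tr).
Qed.

Lemma choquet_loss_concentration Pi x : possibility_procedure Theta Pi ->
  choquet_loss Theta (concentration_penalty Theta Pi) Pi x =
  (\int[lebesgue_measure]_(alpha in `[0%R, 1%R])
     lebesgue_measure (cut Theta Pi alpha x))%E.
Proof.
by move=> HPi; apply: eq_integral => alpha _; exact: ereal_sup_concentration.
Qed.

Lemma measurable_cut_length Pi : possibility_procedure Theta Pi ->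
  measurable_fun [set: X * R]
    ((fun z => lebesgue_measure (cut Theta Pi z.2 z.1)) : X * R -> \bar R).
Proof.
move=> /measurable_cut_graph /(measurable_fun_xsection lebesgue_measure).
by apply: eq_measurable_fun => z _ /=; rewrite xsectionE.
Qed.

Lemma measurable_expected_length Pi theta : possibility_procedure Theta Pi ->
  measurable_fun [set: R]
    ((fun alpha => expected_length P (cut Theta Pi alpha) theta) : R -> \bar R).
Proof.
move=> /measurable_cut_length mF.
have := measurable_fun_fubini_tonelli_G (m1 := P theta) _ mF.
by apply => z; exact: measure_ge0.
Qed.

(** The Choquet risk is the expected length of the cuts, integrated over the
    levels. *)
Lemma choquet_risk_concentration Pi theta : possibility_procedure Theta Pi ->
  choquet_risk Theta P (concentration_penalty Theta Pi) Pi theta =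
  (\int[lebesgue_measure]_(alpha in `[0%R, 1%R])
     expected_length P (cut Theta Pi alpha) theta)%E.
Proof.
move=> HPi.
pose F (z : X * R) : \bar R := lebesgue_measure (cut Theta Pi z.2 z.1).
(* Tonelli is applied to the length truncated to levels in the unit interval. *)
pose G := F \_ ([set: X] `*` `[0, 1]).
have mI : measurable ([set: X] `*` (`[0, 1] : set R)) by exact: measurableX.
have mG : measurable_fun setT G.
  apply/(measurable_restrictT _ mI); apply: measurable_funTS.
  exact: measurable_cut_length.
have G0 z : (0 <= G z)%E by rewrite /G patchE; case: ifP.
have GE x alpha : G (x, alpha) =
    ((fun alpha => lebesgue_measure (cut Theta Pi alpha x)) \_ `[0, 1]) alpha.
  rewrite /G !patchE; congr (if _ then _ else _).
  by apply/idP/idP; rewrite !inE /= => // -[].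
rewrite [RHS]integral_mkcond /choquet_risk.
transitivity (\int[P theta]_x \int[lebesgue_measure]_alpha G (x, alpha))%E.
  apply: eq_integral => x _.
  rewrite choquet_loss_concentration// integral_mkcond.
  by apply: eq_integral => alpha _; rewrite GE.
transitivity (\int[lebesgue_measure]_alpha \int[P theta]_x G (x, alpha))%E.
  exact: (fubini_tonelli (m1 := P theta) (m2 := lebesgue_measure) G mG G0).
apply: eq_integral => alpha _.
rewrite [RHS]patchE; case: ifPn => aI.
  by apply: eq_integral => x _; rewrite GE patchE aI.
by apply: integral0_eq => x _; rewrite GE patchE (negbTE aI).
Qed.

Lemma measurable_coverage_probability Pi alpha theta :
  possibility_procedure Theta Pi ->
  measurable_fun [set: R]
    ((fun t => P theta [set x | cut Theta Pi alpha x t]) : R -> \bar R).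
Proof.
move=> /(@measurable_cut_section _ alpha) /(measurable_fun_ysection (P theta)).
by apply: eq_measurable_fun => t _ /=; rewrite ysectionE.
Qed.

(** The Ghosh-Pratt identity. *)
Lemma expected_length_coverage Pi alpha theta :
  possibility_procedure Theta Pi ->
  expected_length P (cut Theta Pi alpha) theta =
  (\int[lebesgue_measure]_t P theta [set x | cut Theta Pi alpha x t])%E.
Proof.
move=> /(@measurable_cut_section _ alpha) mA.
have := indic_fubini_tonelli (P theta) lebesgue_measure mA.
rewrite indic_fubini_tonelli_FE// indic_fubini_tonelli_GE//.
under eq_integral do rewrite /= xsectionE.
by under [RHS]eq_integral do rewrite /= ysectionE.
Qed.

Lemma choquet_risk_concentration_le Pi1 Pi2 theta :
  possibility_procedure Theta Pi1 -> possibility_procedure Theta Pi2 ->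
  (forall alpha t, 0 <= alpha <= 1 -> Theta t -> t != theta ->
     (P theta [set x | cut Theta Pi1 alpha x t]
        <= P theta [set x | cut Theta Pi2 alpha x t])%E) ->
  (choquet_risk Theta P (concentration_penalty Theta Pi1) Pi1 theta
     <= choquet_risk Theta P (concentration_penalty Theta Pi2) Pi2 theta)%E.
Proof.
move=> H1 H2 H12.
rewrite (choquet_risk_concentration theta H1).
rewrite (choquet_risk_concentration theta H2).
apply: ge0_le_integral => //.
- by move=> alpha _; exact: integral_ge0.
- by apply: measurable_funTS; exact: measurable_expected_length.
- by apply: measurable_funTS; exact: measurable_expected_length.
move=> alpha; rewrite /= in_itv /= => a01.
rewrite !expected_length_coverage//.
have mc Pi : possibility_procedure Theta Pi ->
    measurable_fun ([set: R] `\ theta)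
      ((fun t => P theta [set x | cut Theta Pi alpha x t]) : R -> \bar R).
  move=> HPi; apply: measurable_funTS.
  exact: measurable_coverage_probability.
(* The true parameter is a null set, where coverage need not be compared. *)
have mD : measurable ([set: R] `\ theta) by exact: measurableD.
rewrite -(integral_setD1 mD (mc _ H1)) -(integral_setD1 mD (mc _ H2)).
apply: ge0_le_integral => //; [exact: mc|exact: mc|].
move=> t [_ /= /eqP tn]; have [Tt|nTt] := pselect (Theta t); first exact: H12.
rewrite (_ : [set x | cut Theta Pi1 alpha x t] = set0) ?measure0//.
by apply/seteqP; split => x //= -[].
Qed.

End cuts.

(** * Stacked contours *)

Section probability_of_complement.
Context {d : measure_display} {X : measurableType d} {R : realType}.
Variables (P : probability X R) (A : set X) (c : R).
Hypothesis mA : measurable A.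

Lemma probability_setC_le : (P (~` A) <= c%:E)%E = ((1 - c)%:E <= P A)%E.
Proof.
rewrite probability_setC// -(fineK (fin_num_measure P A mA)) -EFinB !lee_fin.
by rewrite !lerBlDr addrC.
Qed.

Lemma probability_setC_ge : (c%:E <= P (~` A))%E = (P A <= (1 - c)%:E)%E.
Proof.
rewrite probability_setC// -(fineK (fin_num_measure P A mA)) -EFinB !lee_fin.
by rewrite !lerBrDr addrC.
Qed.

End probability_of_complement.

Section stacked_contours.
Context {d : measure_display} {X : measurableType d} {R : realType}.
Variable C : R -> X -> set R.

Lemma contour_possibility_of (pi : X -> R -> R) :
  contour (possibility_of pi) = pi.
Proof.
by apply/funext => x; apply/funext => t;
   rewrite /contour /possibility_of image_set1 sup1.
Qed.

Lemma stacked_contour_has_ubound x t :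
  has_ubound [set alpha | 0 < alpha < 1 /\ C alpha x t].
Proof. by exists 1 => alpha [/andP[_ /ltW]]. Qed.

Lemma le_stacked_contour alpha x t : 0 < alpha < 1 -> C alpha x t ->
  alpha <= stacked_contour C x t.
Proof.
by move=> a01 Ca; apply: ub_le_sup => //; exact: stacked_contour_has_ubound.
Qed.

Lemma stacked_contour_itv x t : 0 <= stacked_contour C x t <= 1.
Proof.
rewrite /stacked_contour; set S := [set _ | _].
have [->|/set0P S0] := eqVneq S set0; first by rewrite sup0 lexx ler01.
apply/andP; split; last by apply: ge_sup => // alpha [/andP[_ /ltW]].
have [alpha Sa] := S0; apply: (@le_trans _ _ alpha).
  by case: Sa => /andP[/ltW].
by apply: ub_le_sup => //; exact: stacked_contour_has_ubound.
Qed.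

Hypothesis nested : forall alpha1 alpha2 : R, 0 < alpha1 -> alpha1 < alpha2 ->
  alpha2 < 1 -> forall x, C alpha2 x `<=` C alpha1 x.

Lemma lt_stacked_contour alpha x t :
  0 < alpha -> alpha < stacked_contour C x t ->
  C alpha x t.
Proof.
move=> a0 asc.
have S0 : [set beta | 0 < beta < 1 /\ C beta x t] !=set0.
  apply/set0P/eqP => S0; move: asc; rewrite /stacked_contour S0 sup0.
  by rewrite ltNge (ltW a0).
have sc0 : 0 < stacked_contour C x t - alpha by rewrite subr_gt0.
have [beta [/andP[b0 b1] Cb]] :=
  sup_adherent sc0 (conj S0 (@stacked_contour_has_ubound x t)).
by rewrite opprB addrC subrK => ab; exact: nested Cb.
Qed.

Lemma measurable_stacked_contour (Theta : set R) : measurable Theta ->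
  (forall alpha, 0 < alpha < 1 ->
     measurable [set z : X * R | C alpha z.1 z.2]) ->
  measurable_fun ([set: X] `*` Theta)
    (fun z : X * R => stacked_contour C z.1 z.2).
Proof.
move=> mTheta mC; apply: measurable_funTS.
apply: (measurability _ (RGenOInfty.measurableE R)) => // _ [_ [r ->] <-].
rewrite setTI.
have [r0|r0] := ltP r 0.
  rewrite (_ : _ @^-1` _ = setT)//; apply/seteqP; split => z //= _.
  rewrite in_itv/= andbT; apply: lt_le_trans r0 _.
  by have /andP[] := stacked_contour_itv z.1 z.2.
(* The superlevel set at [r] is the union of the sets of rational levels above
   [r]. *)
pose F (q : rat) := if r < (ratr q : R) < 1
  then [set z : X * R | C (ratr q) z.1 z.2] else set0.
rewrite (_ : _ @^-1` _ = \bigcup_q F q).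
  apply: countable_bigcupT_measurable => [|q]; first exact: countableP.
  rewrite /F; case: ifPn => // /andP[rq q1]; apply: mC.
  by rewrite q1 (le_lt_trans r0).
apply/seteqP; split => z /=; rewrite in_itv/= andbT.
  move=> /rat_in_itvoo[q]; rewrite in_itv/= => /andP[rq qs].
  exists q => //; rewrite /F rq (lt_le_trans qs) /=; last first.
    by have /andP[] := stacked_contour_itv z.1 z.2.
  by apply: lt_stacked_contour => //; exact: le_lt_trans rq.
move=> [q _]; rewrite /F; case: ifPn => // /andP[rq q1] /= Cq.
apply: (lt_le_trans rq); apply: le_stacked_contour => //.
by rewrite q1 (le_lt_trans r0 rq).
Qed.

Lemma stacked_possibility_procedure (Theta : set R) : measurable Theta ->
  (forall alpha, 0 < alpha < 1 ->
     measurable [set z : X * R | C alpha z.1 z.2]) ->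
  possibility_procedure Theta (possibility_of (stacked_contour C)).
Proof.
move=> mTheta mC; rewrite /possibility_procedure contour_possibility_of.
split => // [x t _|]; first exact: stacked_contour_itv.
exact: measurable_stacked_contour.
Qed.

End stacked_contours.

(** A set convex within [Theta] is the trace of its convex hull. *)
Lemma interval_valued_convex (d : measure_display) (X : measurableType d)
    (R : realType) (Theta : set R) (C : X -> set R) :
  (forall x, C x `<=` Theta) ->
  (forall x s t r, C x s -> C x t -> Theta r -> s <= r <= t -> C x r) ->
  interval_valued Theta C.
Proof.
move=> CTheta Cconv x.
exists [set r | exists s t, [/\ C x s, C x t & s <= r <= t]].
  move=> r1 r2 [s [_ [Cs _ /andP[sr1 _]]]] [_ [t [_ Ct /andP[_ r2t]]]] r.
  move=> /andP[r1r rr2]; exists s, t; split => //.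
  by rewrite (le_trans sr1)//= (le_trans rr2).
apply/seteqP; split => [t Ct|r [Tr [s [t [Cs Ct srt]]]]].
  by split; [exact: CTheta Ct|exists t, t; rewrite lexx].
exact: Cconv Cs Ct Tr srt.
Qed.

(** * The stacked procedure *)

(** The stacking of a nested family [C] of most accurate unbiased confidence
    sets with false coverage at most the nominal confidence level. *)
Section stacked_procedure.
Context {d : measure_display} {X : measurableType d} {R : realType}.
Variables (Theta : set R) (mTheta : measurable Theta).
Variables (P : R -> probability X R) (C : R -> X -> set R).
Hypothesis nested : forall alpha1 alpha2 : R, 0 < alpha1 -> alpha1 < alpha2 ->
  alpha2 < 1 -> forall x, C alpha2 x `<=` C alpha1 x.
Hypothesis mC : forall alpha, 0 < alpha < 1 ->
  measurable [set z : X * R | C alpha z.1 z.2].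
Hypothesis accurate : forall alpha, 0 < alpha < 1 ->
  most_accurate_unbiased Theta P alpha (C alpha).
Hypothesis false_coverage : forall alpha theta vartheta, 0 < alpha < 1 ->
  Theta theta -> Theta vartheta -> vartheta != theta ->
  (P vartheta [set x | C alpha x theta] <= (1 - alpha)%:E)%E.

Let sc := stacked_contour C.
Let Pi := possibility_of sc.

Let HPi : possibility_procedure Theta Pi.
Proof. exact: stacked_possibility_procedure. Qed.

Let msc t : Theta t -> measurable_fun [set: X] (fun x => sc x t).
Proof.
move=> /(measurable_contour mTheta HPi).
by rewrite /Pi contour_possibility_of.
Qed.

Let mCt alpha t : 0 < alpha < 1 -> Theta t -> measurable [set x | C alpha x t].
Proof. by move=> /accurate[[[_ + _] _] _]; exact. Qed.

Let noncoverage_le beta t : 0 < beta < 1 -> Theta t ->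
  (P t (~` [set x | C beta x t]) <= beta%:E)%E.
Proof.
move=> b01 Tt; rewrite probability_setC_le//; last exact: mCt.
by have [[[_ _ +] _] _] := accurate b01; exact.
Qed.

Let measurable_lt r t : Theta t -> measurable [set x | sc x t < r].
Proof.
move=> Tt; rewrite (_ : [set x | _] = (fun x => sc x t) @^-1` `]-oo, r[).
  by rewrite -[X in measurable X]setTI; exact: msc.
by apply/seteqP; split => x /=; rewrite in_itv.
Qed.

Let measurable_gt r t : Theta t -> measurable [set x | r < sc x t].
Proof.
move=> Tt; rewrite -[X in measurable X]setTI.
by apply: measurable_superlevel => //; exact: msc.
Qed.

Lemma stacked_valid : valid Theta P Pi.
Proof.
move=> theta alpha Tt /andP[a0 a1]; rewrite /Pi contour_possibility_of.
apply: measure_sublevel_le => [|s sa]; first exact: msc.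
have [s0|s0] := leP s 0.
  rewrite (_ : [set x | _] = set0) ?measure0 ?lee_fin//.
  apply/seteqP; split => x //= /lt_le_trans/(_ s0).
  by rewrite ltNge; have /andP[->] := stacked_contour_itv C x theta.
have s01 : 0 < s < 1 by rewrite s0 (lt_le_trans sa).
apply: le_trans (_ : s%:E <= _)%E; last by rewrite lee_fin ltW.
apply: le_trans (noncoverage_le s01 Tt); apply: le_measure.
- by rewrite inE; exact: measurable_lt.
- by rewrite inE; apply: measurableC; exact: mCt.
- by move=> x /= xs Cs; move: xs; rewrite ltNge le_stacked_contour.
Qed.

Let exceedance_le theta vartheta alpha : Theta theta -> Theta vartheta ->
  vartheta != theta -> 0 <= alpha < 1 ->
  (P vartheta [set x | (alpha < sc x theta)%R] <= (1 - alpha)%:E)%E.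
Proof.
move=> Tt Tv vt /andP[a0 a1]; rewrite -[[set x | _]]setTI.
apply: measure_superlevel_le => // [|s as_]; first exact: msc.
rewrite setTI; have [s1|s1] := leP 1 s.
  rewrite (_ : [set x | _] = set0) ?measure0 ?lee_fin ?subr_ge0 ?(ltW a1)//.
  apply/seteqP; split => x //= /(le_lt_trans s1).
  by rewrite ltNge; have /andP[_ ->] := stacked_contour_itv C x theta.
have s0 : 0 < s by exact: le_lt_trans as_.
have s01 : 0 < s < 1 by rewrite s0.
apply: (@le_trans _ _ (1 - s)%:E); last by rewrite lee_fin lerB// ltW.
apply: le_trans (false_coverage s01 Tt Tv vt); apply: le_measure.
- by rewrite inE; exact: measurable_gt.
- by rewrite inE; exact: mCt.
- by move=> x; exact: lt_stacked_contour.
Qed.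

Lemma stacked_possibilistically_unbiased :
  possibilistically_unbiased Theta P Pi.
Proof.
move=> theta vartheta alpha Tt Tv /andP[a0 a1].
rewrite /Pi contour_possibility_of.
have [->//|vt] := eqVneq vartheta theta.
have [a_ge1|a_lt1] := leP 1 alpha.
  rewrite (_ : [set x | _] = setT) ?probability_setT//.
  apply/seteqP; split => x //= _; apply: le_trans a_ge1.
  by have /andP[] := stacked_contour_itv C x theta.
have scE : [set x | sc x theta <= alpha] = ~` [set x | alpha < sc x theta].
  by apply/seteqP; split => x /=; rewrite leNgt => /negP.
(* The level separates the two probabilities. *)
apply: (@le_trans _ _ alpha%:E); last first.
  rewrite scE probability_setC_ge//; last exact: measurable_gt.
  by apply: exceedance_le => //; rewrite a0.
apply/lee_addgt0Pr => e e0.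
(* Above [alpha], but below [1] and within [e]. *)
pose s := Num.min (alpha + e) ((1 + alpha) / 2).
have as_ : alpha < s.
  by rewrite lt_min ltrDl e0 ltr_pdivlMr// mulr_natr mulr2n ltrD2r.
have s01 : 0 < s < 1.
  rewrite (le_lt_trans a0 as_)/= gt_min; apply/orP; right.
  by rewrite ltr_pdivrMr// mul1r -[ltRHS]/(1 + 1) ltrD2l.
apply: (@le_trans _ _ s%:E); last by rewrite -EFinD lee_fin ge_min lexx.
apply: le_trans (noncoverage_le s01 Tt); apply: le_measure.
- by rewrite inE scE; apply: measurableC; exact: measurable_gt.
- by rewrite inE; apply: measurableC; exact: mCt.
- move=> x /= xs Cs; move: (le_lt_trans xs as_).
  by rewrite ltNge le_stacked_contour.
Qed.

Let cutE alpha x t : cut Theta Pi alpha x t = (Theta t /\ alpha <= sc x t).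
Proof. by rewrite /Defs.cut /= /Pi contour_possibility_of. Qed.

Let cut_sub alpha beta x : 0 < beta -> beta < alpha ->
  cut Theta Pi alpha x `<=` C beta x.
Proof.
move=> b0 ba t; rewrite cutE => -[Tt at_].
by apply: lt_stacked_contour => //; exact: lt_le_trans at_.
Qed.

Lemma stacked_cut_coverage alpha theta : 0 < alpha < 1 -> Theta theta ->
  ((1 - alpha)%:E <= P theta [set x | cut Theta Pi alpha x theta])%E.
Proof.
move=> /andP[a0 a1] Tt.
rewrite -probability_setC_le; last exact: measurable_coverage.
rewrite (_ : ~` _ = [set x | contour Pi x theta < alpha]).
  by apply: stacked_valid => //; rewrite !ltW.
rewrite /Pi contour_possibility_of.
apply/seteqP; split => x /=; rewrite cutE ltNge.
  by move=> H; apply/negP => ?; exact: H.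
by move=> /negP H [].
Qed.

Lemma stacked_cut_false_coverage alpha theta vartheta : 0 < alpha < 1 ->
  Theta theta -> Theta vartheta -> vartheta != theta ->
  (P vartheta [set x | cut Theta Pi alpha x theta] <= (1 - alpha)%:E)%E.
Proof.
move=> /andP[a0 a1] Tt Tv vt; apply/lee_addgt0Pr => e e0.
(* Below [alpha], but positive and within [e]. *)
pose s := Num.max (alpha - e) (alpha / 2).
have as_ : s < alpha.
  by rewrite gt_max ltrBlDr ltrDl e0 ltr_pdivrMr// mulr_natr mulr2n ltrDl.
have s0 : 0 < s by rewrite lt_max divr_gt0// orbT.
have s01 : 0 < s < 1 by rewrite s0 (lt_trans as_).
apply: (@le_trans _ _ (1 - s)%:E).
  apply: le_trans (false_coverage s01 Tt Tv vt); apply: le_measure.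
  - by rewrite inE; exact: measurable_coverage.
  - by rewrite inE; exact: mCt.
  - by move=> x; exact: cut_sub.
by rewrite -EFinD lee_fin -addrA lerD2l lerNl opprD opprK le_max lexx.
Qed.

Lemma stacked_cut_interval_valued alpha : 0 < alpha < 1 ->
  (forall beta, 0 < beta < 1 -> interval_valued Theta (C beta)) ->
  interval_valued Theta (cut Theta Pi alpha).
Proof.
move=> /andP[a0 a1] HI.
apply: interval_valued_convex => [x t|x s t r Cs Ct Tr srt].
  by rewrite cutE => -[].
rewrite cutE; split => //; rewrite leNgt; apply/negP => scr.
(* The interval [C b x], for [b] between the contour at [r] and [alpha],
   contains [s] and [t], hence [r]. *)
pose b := (Num.max (sc x r) 0 + alpha) / 2.
have mb : Num.max (sc x r) 0 < alpha by rewrite gt_max scr.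
have [mb1 ba] : Num.max (sc x r) 0 < b /\ b < alpha by split; rewrite midf_lt.
have b0 : 0 < b by move: mb1; rewrite gt_max => /andP[].
have b01 : 0 < b < 1 by rewrite b0 (lt_trans ba).
have [J HJ CJ] := HI _ b01 x.
have : C b x r.
  have := cut_sub b0 ba Cs; have := cut_sub b0 ba Ct.
  rewrite CJ => -[_ Jt] [_ Js].
  by split => //; exact: HJ Js Jt _ srt.
move=> /(le_stacked_contour b01); rewrite leNgt => /negP; apply.
by apply: le_lt_trans mb1; rewrite le_max lexx.
Qed.

Lemma stacked_competitor :
  (forall alpha, 0 < alpha < 1 -> interval_valued Theta (C alpha)) ->
  (forall alpha theta, 0 < alpha < 1 -> Theta theta ->
     (expected_length P (C alpha) theta < +oo)%E) ->
  competitor Theta P Pi.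
Proof.
move=> HI HL; split; [exact: HPi|exact: stacked_valid| |].
  exact: stacked_possibilistically_unbiased.
move=> alpha a01; have /andP[a0 a1] := a01.
split; [|exact: stacked_cut_interval_valued|].
  split; first split.
  - by move=> x t; rewrite cutE => -[].
  - by move=> t Tt; exact: measurable_coverage.
  - by move=> t; exact: stacked_cut_coverage.
  move=> theta vartheta Tt Tv; have [->//|vt] := eqVneq vartheta theta.
  exact: le_trans (stacked_cut_false_coverage a01 Tt Tv vt)
    (stacked_cut_coverage a01 Tt).
move=> theta Tt.
have a2 : alpha / 2 < alpha by rewrite ltr_pdivrMr// mulr_natr mulr2n ltrDl.
have a20 : 0 < alpha / 2 by rewrite divr_gt0.
have a201 : 0 < alpha / 2 < 1 by rewrite a20 (lt_trans a2).
apply: le_lt_trans (HL _ _ a201 Tt); apply: ge0_le_integral => //.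
- have := measurable_fun_xsection lebesgue_measure
    (measurable_cut_section mTheta alpha HPi).
  by apply: eq_measurable_fun => x _ /=; rewrite xsectionE.
- have := measurable_fun_xsection lebesgue_measure (mC a201).
  by apply: eq_measurable_fun => x _ /=; rewrite xsectionE.
move=> x _; apply: le_measure.
- by rewrite inE; exact: measurable_cut.
- by rewrite inE; have := measurable_xsection x (mC a201); rewrite xsectionE.
- exact: cut_sub.
Qed.

(** For [s < alpha], the contour of a competitor falls below [s] at [theta] no
    more often than [C s] misses [theta], hence no more often than the stacked
    contour falls below [alpha]; then [s] tends to [alpha]. *)
Lemma stacked_cut_most_accurate Pi' alpha theta vartheta :
  competitor Theta P Pi' -> 0 <= alpha <= 1 ->
  Theta theta -> Theta vartheta -> theta != vartheta ->
  (P vartheta [set x | cut Theta Pi alpha x theta]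
     <= P vartheta [set x | cut Theta Pi' alpha x theta])%E.
Proof.
move=> [HPi' _ _ Hcuts] /andP[a0 a1] Tt Tv tv.
have mc' : measurable_fun [set: X] (fun x => contour Pi' x theta).
  exact: (measurable_contour mTheta HPi').
have c'_ge0 x : 0 <= contour Pi' x theta.
  by have [_ /(_ x _ Tt)/andP[]] := HPi'.
have cutC (Pi0 : X -> set R -> R) (r : R) :
    [set x | cut Theta Pi0 r x theta] = ~` [set x | contour Pi0 x theta < r].
  apply/seteqP; split => x /=; rewrite ltNge; first by move=> [_ ->].
  by move=> /negP; rewrite negbK => ?; split.
have mlt r : measurable [set x | contour Pi' x theta < r].
  rewrite (_ : [set x | _] = (fun x => contour Pi' x theta) @^-1` `]-oo, r[).
    by rewrite -[X in measurable X]setTI; exact: mc'.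
  by apply/seteqP; split => x /=; rewrite in_itv.
have mltsc : measurable [set x | contour Pi x theta < alpha].
  by rewrite /Pi contour_possibility_of; exact: measurable_lt.
rewrite !cutC !probability_setC//; apply: leeB => //.
apply: measure_sublevel_le => // s sa.
have [s0|s0] := leP s 0.
  rewrite (_ : [set x | _] = set0) ?measure0//.
  by apply/seteqP; split => x //= /lt_le_trans/(_ s0); rewrite ltNge c'_ge0.
have s01 : 0 < s < 1 by rewrite s0 (lt_le_trans sa).
have [unb' _ _] := Hcuts _ s01.
have [_ /(_ _ unb' _ _ Tt Tv tv) acc] := accurate s01.
have nacc : (P vartheta (~` [set x | cut Theta Pi' s x theta]) <=
    P vartheta (~` [set x | C s x theta]))%E.
  rewrite probability_setC; last exact: measurable_coverage.
  rewrite probability_setC; last exact: mCt.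
  exact: leeB.
rewrite cutC setCK in nacc; apply: (le_trans nacc).
apply: le_measure.
- by rewrite inE; apply: measurableC; exact: mCt.
- by rewrite inE.
move=> x /= nC; rewrite /Pi contour_possibility_of ltNge; apply/negP => asc.
by apply: nC; apply: lt_stacked_contour => //; exact: lt_le_trans asc.
Qed.

Lemma stacked_concentration_optimal :
  (forall alpha, 0 < alpha < 1 -> interval_valued Theta (C alpha)) ->
  (forall alpha theta, 0 < alpha < 1 -> Theta theta ->
     (expected_length P (C alpha) theta < +oo)%E) ->
  concentration_optimal Theta P Pi.
Proof.
move=> HI HL; split; first exact: stacked_competitor.
move=> Pi' HPi' theta Ttheta.
apply: (choquet_risk_concentration_le mTheta HPi); first by case: HPi'.
by move=> alpha t a01 Tt tt; exact: stacked_cut_most_accurate.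
Qed.

End stacked_procedure.

(** * Inversion of tests *)

Section inverted_tests.
Context {d : measure_display} {X : measurableType d} {R : realType}.
Variables (Theta : set R) (P : R -> probability X R).

Lemma power_test_of_acceptance (T : {mfun X >-> R}) (A : set R) theta :
  measurable A ->
  power P (test_of_acceptance T A) theta = P theta (~` [set x | A (T x)]).
Proof.
move=> mA.
have mTA : measurable (~` [set x | A (T x)]).
  apply: measurableC; rewrite -[X in measurable X]setTI.
  exact: measurable_funPT.
by rewrite /power -[X in _ = P theta X]setIT -integral_indic.
Qed.

Lemma power_affine_indic (S : set X) (k : R) theta : measurable S ->
  0 <= k <= 1 ->
  power P (fun x => (1 - k) + k * \1_(~` S) x) theta =
  (1 - k * fine (P theta S))%:E.
Proof.
move=> mS /andP[k0 k1]; rewrite /power.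
have mi : measurable_fun [set: X] (fun x => (\1_(~` S) x)%:E : \bar R).
  by apply/measurable_EFinP; apply: measurable_indic; exact: measurableC.
under eq_integral do rewrite EFinD EFinM.
rewrite ge0_integralD//=.
- rewrite integral_cst// [X in (_ * X + _)%E](probability_setT (P theta)) mule1.
  rewrite ge0_integralZl// integral_indic//; last exact: measurableC.
  rewrite setIT [X in (_ + _ * X)%E](probability_setC (P theta) mS).
  rewrite -(fineK (fin_num_measure (P theta) S mS)) -EFinB -EFinM -EFinD.
  by congr EFin; rewrite mulrBr mulr1 addrA subrK.
- by move=> x _; rewrite lee_fin subr_ge0.
- by move=> x _; rewrite mule_ge0// lee_fin.
- exact: measurable_funeM.
Qed.

(** The test of [theta] accepting with probability [k] when the confidence set
    contains [theta], and rejecting otherwise; [k] makes its size exactly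
    [alpha]. *)
Lemma unbiased_test_of_confidence_set (C : X -> set R) alpha theta :
  0 < alpha < 1 -> Theta theta -> unbiased_confidence_set Theta P alpha C ->
  let k := (1 - alpha) / fine (P theta [set x | C x theta]) in
  0 <= k <= 1 /\
  unbiased_test Theta P alpha theta
    (fun x => (1 - k) + k * \1_(~` [set x | C x theta]) x).
Proof.
move=> /andP[a0 a1] Tt [[_ mC cov] unb] k.
set S := [set x | C x theta] in k *.
have mS : measurable S by exact: mC.
have PS v : P v S = (fine (P v S))%:E.
  by rewrite fineK//; exact: fin_num_measure.
have q1 : 1 - alpha <= fine (P theta S) by rewrite -lee_fin -PS; exact: cov.
have q0 : 0 < fine (P theta S) by apply: lt_le_trans q1; rewrite subr_gt0.
have k01 : 0 <= k <= 1.
  by rewrite divr_ge0 ?subr_ge0 ?(ltW a1) ?(ltW q0)//= ler_pdivrMr// mul1r.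
have kq : k * fine (P theta S) = 1 - alpha by rewrite divfK// gt_eqF.
split => //; split; last first.
  move=> v Tv _; rewrite power_affine_indic// lee_fin lerBrDr -lerBrDl -kq.
  apply: ler_wpM2l; first by case/andP: k01.
  by rewrite -lee_fin -!PS; exact: unb.
split; last by rewrite power_affine_indic// kq opprB addrCA subrr addr0.
split; last first.
  move=> x; have /andP[k0 k1] := k01; rewrite indicE.
  case: (x \in _); first by rewrite mulr1 subrK ler01 lexx.
  by rewrite mulr0 addr0 subr_ge0 k1 gerBl k0.
apply: measurable_funD => //; apply: measurable_funM => //.
by apply: measurable_indic; exact: measurableC.
Qed.

End inverted_tests.

Lemma measurable_strictly_increasing_on {R : realType} (Theta : set R)
    (f : R -> R) : measurable Theta -> strictly_increasing_on Theta f ->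
  measurable_fun Theta f.
Proof.
move=> mTheta fi.
apply: (measurability _ (RGenOInfty.measurableE R)) => // _ [_ [r ->] <-].
(* The superlevel set of [f] is the trace on [Theta] of an upper set. *)
pose J := [set t | exists s, [/\ Theta s, r < f s & s <= t]].
rewrite (_ : _ `&` _ = Theta `&` J); last first.
  apply/seteqP; split => t [Tt /=]; rewrite in_itv/= andbT.
    by move=> rt; split => //; exists t.
  move=> [s [Ts rs]]; rewrite le_eqVlt => /predU1P[<-//|st].
  by split => //; exact: lt_trans rs (fi _ _ _ _ _).
apply: measurableI => //; apply: is_interval_measurable.
move=> u v [s [Ts rs su]] _ w /andP[uw _].
by exists s; split => //; exact: le_trans uw.
Qed.

Section inverted_set.
Context {d : measure_display} {X : measurableType d} {R : realType}.
Variables (Theta : set R) (T : X -> R) (a b : R -> R -> R) (alpha : R).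
Hypotheses (ai : strictly_increasing_on Theta (a alpha))
  (bi : strictly_increasing_on Theta (b alpha)).

Lemma strictly_increasing_on_le (f : R -> R) s t :
  strictly_increasing_on Theta f -> Theta s -> Theta t ->
  (f s <= f t) = (s <= t).
Proof.
move=> fi Ts Tt; have [st|ts] := leP s t.
  by move: st; rewrite le_eqVlt => /predU1P[->|/fi H]; rewrite ?lexx// ltW// H.
by apply/negbTE; rewrite -ltNge; exact: fi.
Qed.

Lemma inverted_set_interval_valued :
  interval_valued Theta (inverted_set Theta T a b alpha).
Proof.
apply: interval_valued_convex => [x t []//|x s t r].
move=> [Ts /andP[_ Tbs]] [Tt /andP[aT _]] Tr /andP[sr rt].
split => //; apply/andP; split.
  by apply: le_trans aT; rewrite strictly_increasing_on_le.
by apply: (le_trans Tbs); rewrite strictly_increasing_on_le.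
Qed.

Lemma inverted_set_itv x l u : Theta l -> Theta u ->
  b alpha l = T x -> a alpha u = T x ->
  inverted_set Theta T a b alpha x = Theta `&` `[l, u].
Proof.
move=> Tl Tu bl au; apply/seteqP; split => t [Tt].
  rewrite /acceptance_region /= -{1}au -bl !strictly_increasing_on_le//.
  by rewrite in_itv/= andbC.
rewrite /= in_itv/= => /andP[lt_ tu]; split => //.
by rewrite /acceptance_region /= -{1}au -bl !strictly_increasing_on_le// lt_ tu.
Qed.

Lemma measurable_inverted_set : measurable Theta -> measurable_fun [set: X] T ->
  measurable [set z : X * R | inverted_set Theta T a b alpha z.1 z.2].
Proof.
move=> mTheta mT.
pose D := [set: X] `*` Theta.
have mD : measurable D by exact: measurableX.
have mTx : measurable_fun D (fun z => T z.1).
  by apply: measurable_funTS; exact: measurableT_comp.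
have mf (f : R -> R) : strictly_increasing_on Theta f ->
    measurable_fun D (fun z => f z.2).
  move=> fi; apply: (@measurable_comp _ _ _ _ _ _ Theta f _ snd) => //.
  - by move=> _ [z [_ Tz] <-].
  - exact: measurable_strictly_increasing_on.
  - exact: measurable_funTS.
have := measurableI _ _ (measurable_fun_le mD (mf _ ai) mTx)
  (measurable_fun_le mD mTx (mf _ bi)).
congr measurable; apply/seteqP; split => z /=.
  by move=> [[[_ Tz] /= az] [_ /= zb]]; split => //; apply/andP.
by move=> [Tz /andP[az zb]].
Qed.

End inverted_set.

(** Coverage is one minus the size, and false coverage one minus the power, of
    the inverted tests; accuracy is their optimality against the randomized
    tests built from other confidence sets. *)
Lemma inverted_set_most_accurate (d : measure_display) (X : measurableType d)
    (R : realType) (Theta : set R) (P : R -> probability X R)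
    (T : {mfun X >-> R}) (a b : R -> R -> R) (alpha : R) : 0 < alpha < 1 ->
  (forall theta, Theta theta -> UMP_unbiased_test Theta P alpha theta
     (test_of_acceptance T (acceptance_region a b theta alpha))) ->
  most_accurate_unbiased Theta P alpha (inverted_set Theta T a b alpha) /\
  forall theta vartheta, Theta theta -> Theta vartheta -> vartheta != theta ->
    (P vartheta [set x | inverted_set Theta T a b alpha x theta]
       <= (1 - alpha)%:E)%E.
Proof.
move=> a01 HT; set C := inverted_set Theta T a b alpha.
have mA t : measurable (acceptance_region a b t alpha).
  exact: (measurable_itv `[a alpha t, b alpha t]).
have CE t : Theta t ->
    [set x | C x t] = [set x | acceptance_region a b t alpha (T x)].
  by move=> Tt; apply/seteqP; split => x; [case|split].
have mC t : Theta t -> measurable [set x | C x t].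
  by move=> Tt; rewrite CE// -[X in measurable X]setTI; exact: measurable_funPT.
have powE t v : Theta t -> power P (test_of_acceptance T
    (acceptance_region a b t alpha)) v = P v (~` [set x | C x t]).
  by move=> Tt; rewrite power_test_of_acceptance// CE.
have cov t : Theta t -> ((1 - alpha)%:E <= P t [set x | C x t])%E.
  move=> Tt; have [[[_ Hl] _] _] := HT _ Tt; move: Hl.
  by rewrite powE// probability_setC_le//; exact: mC.
have fcov t v : Theta t -> Theta v -> v != t ->
    (P v [set x | C x t] <= (1 - alpha)%:E)%E.
  move=> Tt Tv vt; have [[_ Hu] _] := HT _ Tt; have := Hu v Tv vt.
  by rewrite powE// probability_setC_ge//; exact: mC.
split => //; split.
  split; first by split => // x t [].
  move=> t v Tt Tv; have [->//|vt] := eqVneq v t.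
  exact: le_trans (fcov _ _ Tt Tv vt) (cov _ Tt).
move=> C' unb' t v Tt Tv tv.
have [/andP[k0 k1] upsi] := unbiased_test_of_confidence_set a01 Tt unb'.
set k := (1 - alpha) / _ in k0 k1 upsi.
have mC' : measurable [set x | C' x t] by case: unb' => -[_ + _] _; exact.
have [_ ump] := HT _ Tt.
have := ump _ upsi v Tv; rewrite eq_sym => /(_ tv).
rewrite powE// power_affine_indic ?k0//.
rewrite probability_setC_ge; last exact: mC.
rewrite opprB addrCA subrr addr0 => /le_trans; apply.
rewrite -[leRHS](fineK (fin_num_measure (P v) _ mC')) lee_fin.
by rewrite ler_piMl// fine_ge0.
Qed.

Theorem corollary4p6 (d : measure_display) (X : measurableType d) (R : realType)
    (Theta : set R) (mTheta : measurable Theta)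
    (P : R -> probability X R) (T : {mfun X >-> R})
    (mu : {sigma_finite_measure set R -> \bar R}) (p : R -> R -> R)
    (a b : R -> R -> R)
    (Hdensity : has_density Theta P T mu p)
    (Hmlr : monotone_likelihood_ratio Theta p)
    (Htests : forall alpha theta0 : R, 0 < alpha < 1 -> Theta theta0 ->
       let phi := test_of_acceptance T (acceptance_region a b theta0 alpha) in
       strictly_unbiased_test Theta P alpha theta0 phi /\
       UMP_unbiased_test Theta P alpha theta0 phi)
    (Hincr : forall alpha : R, 0 < alpha < 1 ->
       strictly_increasing_on Theta (a alpha) /\
       strictly_increasing_on Theta (b alpha))
    (Hnested : forall alpha1 alpha2 : R, 0 < alpha1 -> alpha1 < alpha2 ->
       alpha2 < 1 -> forall x,
       inverted_set Theta T a b alpha2 x `<=` inverted_set Theta T a b alpha1 x)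
    (Hlength : forall alpha theta : R, 0 < alpha < 1 -> Theta theta ->
       (expected_length P (inverted_set Theta T a b alpha) theta < +oo)%E) :
  let Cstar := inverted_set Theta T a b in
  let Pistar := possibility_of (stacked_contour Cstar) in
  (forall alpha : R, 0 < alpha < 1 ->
     [/\ most_accurate_unbiased Theta P alpha (Cstar alpha),
         interval_valued Theta (Cstar alpha) &
         forall x l u, Theta l -> Theta u ->
           b alpha l = T x -> a alpha u = T x ->
           Cstar alpha x = Theta `&` `[l, u]]) /\
  [/\ possibility_procedure Theta Pistar,
      valid Theta P Pistar,
      possibilistically_unbiased Theta P Pistar &
      concentration_optimal Theta P Pistar].
Proof.
move=> Cstar Pistar.
have acc alpha (a01 : 0 < alpha < 1) := inverted_set_most_accurate a01
  (fun theta Tt => (Htests alpha theta a01 Tt).2).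
have HI alpha : 0 < alpha < 1 -> interval_valued Theta (Cstar alpha).
  by move=> /Hincr[ai bi]; exact: inverted_set_interval_valued.
have mC alpha : 0 < alpha < 1 ->
    measurable [set z : X * R | Cstar alpha z.1 z.2].
  by move=> /Hincr[ai bi]; exact: measurable_inverted_set.
have accurate alpha (a01 : 0 < alpha < 1) := (acc alpha a01).1.
have false_coverage alpha theta vartheta (a01 : 0 < alpha < 1) :=
  (acc alpha a01).2 theta vartheta.
split.
  move=> alpha a01; have [ai bi] := Hincr _ a01.
  by split; [exact: accurate|exact: HI|move=> x l u; exact: inverted_set_itv].
split.
- exact: stacked_possibility_procedure.
- exact: stacked_valid.
- exact: (stacked_possibilistically_unbiased mTheta Hnested mC accurate).
- exact: (stacked_concentration_optimal mTheta Hnested mC accurate).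
Qed.
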